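(* Let $G$ be a $2$-connected graph. Then $tpc(G)\leq 4$, and there exists a total-coloring of $G$ with $4$ colors that makes $G$ total proper connected and such that $G$ has the strong property with respect to this coloring.
   Context: All graphs are simple, finite and undirected. A graph is total-colored if every vertex and every edge receives a color; $c(x)$ denotes the color of a vertex or edge $x$. A path $v_1v_2\ldots v_s$ in a total-colored graph is a total proper path if (i) any two adjacent edges on the path have different colors, (ii) any two adjacent internal vertices of the path (vertices among $v_2,\ldots,v_{s-1}$) have different colors, and (iii) every internal vertex of the path has a color different from the colors of its two incident edges on the path. A total-colored graph is total proper connected if every two vertices are joined by a total proper path. For a connected graph $G$, the total proper connection number $tpc(G)$ is the smallest number of colors in a total-coloring making $G$ total proper connected. For a path $P=v_1v_2\ldots v_s$ with $s\geq 3$, write $start_e(P)=c(v_1v_2)$, $end_e(P)=c(v_{s-1}v_s)$, $start_v(P)=c(v_2)$, $end_v(P)=c(v_{s-1})$; if $P$ is a single edge $v_1v_s$, then $start_e(P)=end_e(P)=c(v_1v_s)$, $start_v(P)=c(v_s)$ and $end_v(P)=c(v_1)$. Given a total-coloring $c$ making $G$ total proper connected, $G$ has the strong property if for every pair of vertices $u,v$ there exist two (not necessarily disjoint) total proper paths $P_1,P_2$ from $u$ to $v$ such that (1) $c(u)\neq start_v(P_i)$ and $c(v)\neq end_v(P_i)$ for $i=1,2$, and (2) both $\{c(u),start_e(P_1),start_e(P_2)\}$ and $\{c(v),end_e(P_1),end_e(P_2)\}$ are sets of size $3$. *)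

(* Defs.v *)
(* [boolp] only serves to turn the (classical) predicate minimised in
   [tpc] into a boolean one. *)
From mathcomp Require Import all_boot.
From mathcomp Require Import boolp.

Set Implicit Arguments.
Unset Strict Implicit.
Unset Printing Implicit Defensive.

Record sgraph := SGraph {
  vertex :> finType;
  adj : rel vertex;
  adj_sym : symmetric adj;
  adj_irr : irreflexive adj }.

(* The subgraph induced by A is connected (in particular, nonempty). *)
Definition connected_on (G : sgraph) (A : {set G}) : Prop :=
  A != set0 /\
  {in A &, forall x y,
    connect [rel a b : G | [&& a \in A, b \in A & adj a b]] x y}.

Definition connected (G : sgraph) : Prop := connected_on [set: G].

Definition k_connected (k : nat) (G : sgraph) : Prop :=
  k < #|G| /\ forall X : {set G}, #|X| < k -> connected_on (~: X).

Definition two_connected (G : sgraph) : Prop := k_connected 2 G.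

(* The edge xy is the set [set x; y]; the values of ecol at sets of vertices
   that are not edges of G are never used. *)
Record total_coloring (G : sgraph) (C : Type) := TotalColoring {
  vcol : G -> C;
  ecol : {set G} -> C }.

Section TotalProper.
Variables (G : sgraph).

Definition upath (u v : G) (p : seq G) : Prop :=
  [/\ path (@adj G) u p, last u p = v & uniq (u :: p)].

(* The path u :: p has vertices pv u p 0, ..., pv u p (size p) and edges
   pe u p i, joining pv u p i to pv u p i.+1, for i < size p; its internal
   vertices are the pv u p i with 0 < i < size p. *)
Definition pv (u : G) (p : seq G) (i : nat) : G := nth u (u :: p) i.
Definition pe (u : G) (p : seq G) (i : nat) : {set G} :=
  [set pv u p i; pv u p i.+1].

Variables (C : finType) (c : total_coloring G C).

Definition total_proper_path (u v : G) (p : seq G) : Prop :=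
  [/\ upath u v p,
      forall i, i.+1 < size p -> ecol c (pe u p i) <> ecol c (pe u p i.+1),
      forall i, 0 < i -> i.+1 < size p ->
        vcol c (pv u p i) <> vcol c (pv u p i.+1)
    & forall i, 0 < i < size p ->
        vcol c (pv u p i) <> ecol c (pe u p i.-1) /\
        vcol c (pv u p i) <> ecol c (pe u p i)].

Definition total_proper_connected : Prop :=
  forall u v : G, u != v -> exists p, total_proper_path u v p.

(* These are used for paths with at least one edge. For a single edge uv they
   give start_v = c(v) and end_v = c(u), so no case distinction is needed. *)
Definition start_e (u : G) (p : seq G) : C := ecol c (pe u p 0).
Definition end_e (u : G) (p : seq G) : C := ecol c (pe u p (size p).-1).
Definition start_v (u : G) (p : seq G) : C := vcol c (pv u p 1).
Definition end_v (u : G) (p : seq G) : C := vcol c (pv u p (size p).-1).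

Definition strong_property : Prop :=
  forall u v : G, u != v ->
  exists p1 p2 : seq G,
    [/\ total_proper_path u v p1, total_proper_path u v p2,
        [/\ vcol c u <> start_v u p1, vcol c u <> start_v u p2,
            vcol c v <> end_v u p1 & vcol c v <> end_v u p2],
        #|[set vcol c u; start_e u p1; start_e u p2]| = 3
      & #|[set vcol c v; end_e u p1; end_e u p2]| = 3].

End TotalProper.

Definition tpc_colorable (G : sgraph) (k : nat) : Prop :=
  exists c : total_coloring G 'I_k, total_proper_connected c.

Lemma k_connected_connected (k : nat) (G : sgraph) :
  0 < k -> k_connected k G -> connected G.
Proof. by move=> k0 [_ /(_ set0)]; rewrite cards0 setC0; apply. Qed.

Lemma two_connected_connected (G : sgraph) : two_connected G -> connected G.
Proof. exact: k_connected_connected. Qed.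

(* Giving distinct colours to all vertices and edges works. *)
Lemma tpc_colorable_exists (G : sgraph) :
  connected G -> exists k, `[< tpc_colorable G k >].
Proof.
move=> [_ conG]; exists #|{: G + {set G}}|; apply/asboolP.
exists (TotalColoring (fun x => enum_rank (inl x)) (fun e => enum_rank (inr e))).
move=> u v _; have /connectP[q Hq Ev] := conG u v (in_setT u) (in_setT v).
case/shortenP: Hq Ev => p Hp Up _ Ev.
have inj i j : i <= size p -> j <= size p -> pv u p i = pv u p j -> i = j.
  by move=> ip jp /eqP; rewrite /pv nth_uniq // => /eqP.
exists p; split=> /=; first split=> //.
- by apply: sub_path Hp => x y /=; rewrite !inE.
- move=> i ip /enum_rank_inj[] /setP/(_ (pv u p i)).
  rewrite !inE eqxx /= => /esym/orP[]/eqP/inj H.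
  + by have /eqP := H (ltnW (ltnW ip)) (ltnW ip); rewrite -{1}[i]addn0 -addn1 eqn_add2l.
  + have /eqP := H (ltnW (ltnW ip)) ip.
    by rewrite -{1}[i]addn0 -addn2 eqn_add2l.
- move=> i _ ip /enum_rank_inj[] /inj H.
  have /eqP := H (ltnW (ltnW ip)) (ltnW ip).
  by rewrite -{1}[i]addn0 -addn1 eqn_add2l.
- by move=> i _; split=> /enum_rank_inj.
Qed.

Definition tpc (G : sgraph) (connG : connected G) : nat :=
  ex_minn (tpc_colorable_exists connG).

(* Main.v *)
Require Import Defs.
From mathcomp Require Import all_boot.
From mathcomp Require Import boolp zify.

Set Implicit Arguments.
Unset Strict Implicit.
Unset Printing Implicit Defensive.

(** Grow a vertex set [A] by ears.  Besides its colour, every vertex [x] of [A]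
    carries a labelling of the other three colours by three labels, such that
    for all [x <> y] in [A] and all labels [m <> m'] some properly totally
    coloured path of [A] (ends included) joins [x] to [y], its first edge not
    labelled [m] at [x] and its last edge not labelled [m'] at [y].

    Let an ear run from [u] to [v], its first edge labelled [l] at [u] and its
    last edge labelled [l' <> l] at [v].  At an inner vertex of the ear, label
    the edge towards [u] by [l'] and the edge towards [v] by [l].  A route
    leaving such a vertex through [u] starts with label [l'] and can be
    continued in [A] so as to avoid, at its end, any given label other than
    [l]; a route through [v] behaves the same with [l] and [l'] exchanged.
    Whenever [m <> m'], one of these two routes avoids [m] and [m'].

    Three labels then yield two paths whose first edges differ and whose last
    edges differ, which is the strong property. *)

(** * Properly coloured paths with prescribed first and last edge colours *)

Section Linked.
Variables (G : sgraph) (C : finType).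
Implicit Types (c : total_coloring G C) (B : G -> Prop) (u v w z : G).

Definition proper_edge c : rel G := fun x y =>
  [&& adj x y, vcol c x != vcol c y, ecol c [set x; y] != vcol c x
    & ecol c [set x; y] != vcol c y].

Definition edge_colors c u (p : seq G) : seq C :=
  pairmap (fun x y => ecol c [set x; y]) u p.

(** Every edge is tested against both of its ends, the extreme vertices [u] and [v] included. The
    relation is thus local: gluing two such paths at a vertex only requires comparing the two edge
    colours that meet there. Writing the edge colours as [a :: es] excludes the empty path. *)
Definition linked c B u a v b : Prop :=
  exists p es,
    [/\ path (proper_edge c) u p, last u p = v, uniq (u :: p),
        forall z, z \in u :: p -> B z
      & [/\ edge_colors c u p = a :: es, last a es = b
          & path (fun x y => x != y) a es]].

Lemma proper_edge_sym c : symmetric (proper_edge c).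
Proof.
move=> x y; rewrite /proper_edge (adj_sym x) (setUC [set x]).
by rewrite (eq_sym (vcol c x)); congr [&& _, _ & _]; apply: andbC.
Qed.

Lemma last_rev_belast u (p : seq G) : last (last u p) (rev (belast u p)) = u.
Proof. by case: p => //= x p; rewrite rev_cons last_rcons. Qed.

Lemma edge_colors_rev c u p :
  edge_colors c (last u p) (rev (belast u p)) = rev (edge_colors c u p).
Proof.
elim: p u => //= x p IH u.
rewrite !rev_cons /edge_colors -cats1 pairmap_cat -/(edge_colors _ _ _) IH /=.
by rewrite last_rev_belast cats1 setUC.
Qed.

Lemma linked_sub c B B' u a v b :
  (forall z, B z -> B' z) -> linked c B u a v b -> linked c B' u a v b.
Proof.
by move=> sub [p [es [Pp Lp Up Bp Ep]]]; exists p, es; split=> // z /Bp/sub.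
Qed.

Lemma linked_sym c B u a v b : linked c B u a v b -> linked c B v b u a.
Proof.
move=> [p [es [Pp Lp Up Bp [Ep Le Pe]]]].
have revp : v :: rev (belast u p) = rev (u :: p).
  by rewrite [u :: p]lastI rev_rcons Lp.
exists (rev (belast u p)), (rev (belast a es)); split.
- rewrite -Lp rev_path (eq_path (e' := proper_edge c)) // => x y.
  exact: proper_edge_sym.
- by rewrite -Lp last_rev_belast.
- by rewrite revp rev_uniq.
- by move=> z; rewrite revp mem_rev => /Bp.
split.
- by rewrite -Lp edge_colors_rev Ep [a :: es]lastI rev_rcons Le.
- by rewrite -Le; case: (es) => //= x s; rewrite rev_cons last_rcons.
- rewrite -Le rev_path (eq_path (e' := fun x y => x != y)) // => x y.
  by rewrite eq_sym.
Qed.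

Lemma linked_edge c B u v :
  proper_edge c u v -> B u -> B v ->
  linked c B u (ecol c [set u; v]) v (ecol c [set u; v]).
Proof.
move=> e Bu Bv; exists [:: v], [::]; split=> //=; first by rewrite e.
  rewrite inE andbT; apply/eqP=> uv.
  by case/and4P: e => _; rewrite uv eqxx.
by move=> z; rewrite !inE => /orP[]/eqP->.
Qed.

Lemma linked_cat c B B' B'' u a w b b' v a' :
  linked c B u a w b -> linked c B' w b' v a' -> b != b' ->
  (forall z, B z -> B' z -> z = w) ->
  (forall z, B z -> B'' z) -> (forall z, B' z -> B'' z) ->
  linked c B'' u a v a'.
Proof.
move=> [p [es [Pp Lp Up Bp [Ep Le Pe]]]] [q [fs [Pq Lq Uq Bq [Eq Lf Pf]]]].
move=> nb disj subB subB'.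
exists (p ++ q), (es ++ b' :: fs); split.
- by rewrite cat_path Pp Lp.
- by rewrite last_cat Lp.
- move: Uq; rewrite -cat_cons cat_uniq Up /= => /andP[wq ->]; rewrite andbT.
  apply/hasPn => z zq; apply/negP => zp.
  have zw : z = w by apply: disj; [exact: Bp|apply: Bq; rewrite inE zq orbT].
  by rewrite zw in zq; rewrite zq in wq.
- move=> z; rewrite -cat_cons mem_cat => /orP[/Bp/subB //|zq].
  by apply/subB'/Bq; rewrite inE zq orbT.
split.
- by rewrite /edge_colors pairmap_cat Lp -!/(edge_colors _ _ _) Ep Eq.
- by rewrite last_cat /=.
- by rewrite cat_path Pe /= Le nb.
Qed.

Lemma linked_recolor c c' B u a v b :
  (forall x, B x -> vcol c' x = vcol c x) ->
  (forall x y, B x -> B y -> ecol c' [set x; y] = ecol c [set x; y]) ->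
  linked c B u a v b -> linked c' B u a v b.
Proof.
move=> eqv eqe [p [es [Pp Lp Up Bp [Ep Le Pe]]]].
exists p, es; split=> //; last split=> //.
  elim: p u Pp {Lp Up Ep} Bp => //= x p IH u /andP[e Pp] Bp.
  have Bu : B u by apply: Bp; rewrite inE eqxx.
  have Bx : B x by apply: Bp; rewrite !inE eqxx orbT.
  rewrite IH ?andbT // => [|z zp]; last by apply: Bp; rewrite inE zp orbT.
  by move: e; rewrite /proper_edge !eqv ?eqe.
rewrite -Ep; elim: p u Bp {Pp Lp Up Ep} => //= x p IH u Bp.
rewrite eqe ?IH // => [z zp||]; apply: Bp; rewrite !inE ?eqxx ?orbT //.
by rewrite -in_cons zp orbT.
Qed.

(** Because the extreme vertices are tested too, condition (1) of the strong property and the part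
    of (2) about the vertex colours come with each path. It remains to find two paths with different
    first edge colours and different last ones. *)
Lemma linked_total_proper c B u a v b : linked c B u a v b ->
  exists p, [/\ total_proper_path c u v p,
    start_e c u p = a, end_e c u p = b,
    vcol c u <> start_v c u p /\ vcol c v <> end_v c u p
    & vcol c u <> a /\ vcol c v <> b].
Proof.
move=> [p [es [Pp Lp Up Bp [Ep Le Pe]]]]; exists p.
have sz : size p = (size es).+1.
  rewrite -(size_pairmap (fun x y => ecol c [set x; y]) u p).
  by rewrite -/(edge_colors c u p) Ep.
have nthE i : i < size p -> ecol c (pe u p i) = nth a (a :: es) i.
  by move=> ip; rewrite -Ep /edge_colors (nth_pairmap u).
have Epath i : i < size p -> proper_edge c (pv u p i) (pv u p i.+1).
  by move=> ip; have /(pathP u) := Pp; apply.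
have Lpv : pv u p (size p) = v by rewrite /pv -Lp (last_nth u).
have aE : start_e c u p = a by rewrite /start_e nthE // sz.
have bE : end_e c u p = b.
  by rewrite /end_e nthE sz //= -Le (last_nth a).
have e0 := Epath 0; have el := Epath (size p).-1.
rewrite sz /= in e0 el; have {}e0 := e0 isT; have {}el := el (ltnSn _).
rewrite -sz Lpv in el.
split=> //.
- split.
  + by split=> //; apply: sub_path Pp => x y /and4P[].
  + move=> i ip; rewrite !nthE //; last exact: ltnW.
    have /(pathP a)/(_ i) := Pe; rewrite -ltnS -sz => /(_ ip) /eqP.
    by [].
  + by move=> i i0 ip; case/and4P: (Epath i (ltnW ip)) => _ /eqP.
  + move=> [//|i] /andP[_ ip]; split=> /=.
      by case/and4P: (Epath i (ltnW ip)) => _ _ _ /eqP ne /esym.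
    by case/and4P: (Epath i.+1 ip) => _ _ /eqP ne _ /esym.
- split; first by case/and4P: e0 => _ /eqP.
  by case/and4P: el => _ /eqP ne _ _; rewrite /end_v sz /= => /esym.
- rewrite -aE -bE; split; first by case/and4P: e0 => _ _ /eqP ne _ /esym.
  case/and4P: el => _ _ _ /eqP ne; rewrite /end_e sz /=.
  by rewrite /pe -sz Lpv => /esym.
Qed.

End Linked.

(** * Four-colour sequences with prescribed beginning and end *)

Lemma exists_notin n (s : seq 'I_n) : size s < n -> exists a, a \notin s.
Proof.
move=> lt_s; apply/existsP; rewrite -negb_forall; apply/negP => /forallP all_s.
have : #|'I_n| <= size s.
  by rewrite (leq_trans _ (card_size s)) // subset_leq_card //; apply/subsetP.
by rewrite card_ord leqNgt lt_s.
Qed.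

(* The colours along a path, vertices and edges alternately, form such a
   sequence exactly when the path is properly totally coloured, ends included. *)
Definition spaced (C : eqType) n (s : nat -> C) : Prop :=
  forall j, (j < n -> s j != s j.+1) /\ (j.+1 < n -> s j != s j.+2).

Definition scons (T : Type) (a : T) (s : nat -> T) : nat -> T :=
  fun j => if j is i.+1 then s i else a.

Lemma spaced_cons (C : eqType) n (a : C) s :
  a != s 0 -> (0 < n -> a != s 1) -> spaced n s -> spaced n.+1 (scons a s).
Proof. by move=> a0 a1 sp [|j]; [split|have [] := sp j; split]. Qed.

(** The disjunction rules out the one obstruction at [k = 0]: if [x = r] and [y = t], the neighbours
    of the middle entry must be the two colours other than [x] and [y], and no colour is left for
    the middle one. *)
Lemma spaced_fill_long k (x y r t : 'I_4) :
  x != y -> r != t -> (x != r) || (y != t) ->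
  exists s, [/\ spaced (k.*2 + 6) s, s 0 = x, s 1 = y, s (k.*2 + 5) = r
              & s (k.*2 + 6) = t].
Proof.
elim: k x y => [|k IH] x y xy rt ne.
  suff [a [e [b /and5P[/andP[xa ya] /andP[ye ae] /andP[ab eb] /andP[er br] bt]]]] :
      exists a e b, [&& (x != a) && (y != a), (y != e) && (a != e),
        (a != b) && (e != b), (e != r) && (b != r) & b != t].
    exists (scons x (scons y (scons a (scons e (scons b (scons r (fun=> t))))))).
    by split=> //; do 6?[apply: spaced_cons => //].
  (* The middle entry [e] of [x y a e b r t] must avoid [y], [a], [b] and [r]. A coincidence among
     these frees a colour: [y = r] in the first case, [b = y] in the second, [a = r] in the
     third. *)
  have [yr|yr] := eqVneq y r.
    have [a] := @exists_notin 4 [:: x; y] isT.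
    have [b] := @exists_notin 4 [:: r; t; a] isT.
    have [e] := @exists_notin 4 [:: y; a; b] isT.
    rewrite !inE !negb_or => /and3P[ey ea eb] /and3P[br bt ba] /andP[ax ay].
    exists a, e, b; rewrite (eq_sym x) ax (eq_sym y) ay (eq_sym y) ey.
    rewrite (eq_sym a) ea.
    by rewrite (eq_sym a) ba eb -yr ey yr br bt.
  have [xr|xr] := eqVneq x r.
    have yt : y != t by move: ne; rewrite xr eqxx.
    have [a] := @exists_notin 4 [:: x; y] isT.
    have [e] := @exists_notin 4 [:: y; r; a] isT.
    rewrite !inE !negb_or => /and3P[ey er ea] /andP[ax ay].
    exists a, e, y; rewrite (eq_sym x) ax (eq_sym y a) ay (eq_sym y) ey.
    rewrite (eq_sym a) ea.
    by rewrite er yr yt.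
  have [b] := @exists_notin 4 [:: r; t] isT.
  have [e] := @exists_notin 4 [:: y; r; b] isT.
  rewrite !inE !negb_or => /and3P[ey er eb] /andP[br bt].
  by exists r, e, b; rewrite xr yr (eq_sym y) ey (eq_sym r) er (eq_sym r) br eb bt.
(* Taking [a] different from [r] secures the disjunction for the shorter sequence starting with [a],
   [e]. *)
have [a] := @exists_notin 4 [:: x; y; r] isT.
have [e] := @exists_notin 4 [:: y; a] isT.
rewrite !inE !negb_or => /andP[ey ea] /and3P[ax ay ar].
have [||s [sp s0 s1 sr st]] := IH a e _ rt; rewrite ?ar // 1?eq_sym //.
exists (scons x (scons y s)); split=> //.
by do 2?[apply: spaced_cons]; rewrite //= ?s0 ?s1 // eq_sym.
Qed.

(** This is the length of an ear with [k + 2] edges. With two edges, the single free entry must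
    avoid [x], [y], [r] and [t], which is possible because [t] is [x] or [y]. *)
Lemma spaced_fill k (x y r t : 'I_4) :
  x != y -> x != r -> y != r -> (t == x) || (t == y) ->
  exists s, [/\ spaced (k.*2 + 4) s, s 0 = x, s 1 = y, s (k.*2 + 3) = r
              & s (k.*2 + 4) = t].
Proof.
move=> xy xr yr txy.
have rt : r != t by rewrite eq_sym; case/orP: txy => /eqP->.
case: k => [|k]; last first.
  have [|s] := @spaced_fill_long k x y r t xy rt; first by rewrite xr.
  by move=> [sp s0 s1 sr st]; exists s; split; rewrite // doubleS 2!addSnnS.
have [a] := @exists_notin 4 [:: x; y; r] isT.
rewrite !inE !negb_or => /and3P[ax ay ar].
have at' : a != t by case/orP: txy => /eqP->.
exists (scons x (scons y (scons a (scons r (fun=> t))))); split=> //.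
by do 4?[apply: spaced_cons => //=]; move=> *; rewrite // eq_sym.
Qed.

(** * Ears in a 2-connected graph *)

(** By connectivity some edge [ux] leaves [A]. The graph without [u] is still connected, so [x]
    reaches another vertex of [A] there; stopping at the first vertex [v] of [A] gives an ear with
    distinct ends. *)
Lemma exists_ear (G : sgraph) (A : {set G}) :
  two_connected G -> 1 < #|A| -> A != setT ->
  exists n (w : nat -> G),
    [/\ [/\ 1 < n, w 0 \in A & w n \in A],
        forall h, 0 < h < n -> w h \notin A,
        forall h h', h <= n -> h' <= n -> w h = w h' -> h = h'
      & forall h, h < n -> adj (w h) (w h.+1)].
Proof.
move=> [_ conn] A1 AT.
have [u [x [uA xA ux]]] : exists u x, [/\ u \in A, x \notin A & adj u x].
  have [a aA] : exists a, a \in A by apply/card_gt0P/ltnW.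
  have [b bA] : exists b, b \notin A.
    by apply/existsP; rewrite -negb_forall; apply: contra AT => /forallP AT;
       apply/eqP/setP=> z; rewrite AT inE.
  have [_ /(_ a b)] : connected_on (~: (set0 : {set G})).
    by apply: conn; rewrite cards0.
  rewrite setC0 !inE => /(_ isT isT) /connectP[p].
  elim: p a aA => [|z p IH] a aA /=; first by move=> _ ba; rewrite ba aA in bA.
  case/andP; rewrite !inE /= => az Pp Lb.
  have [zA|zA] := boolP (z \in A); first exact: (IH z).
  by exists a, z.
have [a aA au] : exists2 a, a \in A & a != u.
  have /card_gt0P[a] : 0 < #|A :\ u| by move: A1; rewrite (cardsD1 u) uA.
  by rewrite !inE => /andP[]; exists a.
have [_ /(_ x a)] : connected_on (~: [set u]) by apply: conn; rewrite cards1.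
have xu : x != u by apply: contraNneq xA => ->.
rewrite !inE => /(_ xu au) /connectP[p0 Pp0].
case/shortenP: Pp0 => p Pp Up _ {p0} La.
have hasA : has (mem A) p.
  apply/hasP; exists a => //.
  by case: (p) La xA aA => [->|y q ->] /=; [move/negP|rewrite mem_last].
case/split_find: hasA Pp Up La => v p1 p2 /= vA p1A; rewrite cat_path.
move=> /andP[Pp _] Up _.
pose q := x :: rcons p1 v; pose w := nth u (u :: q).
have qP z : z \in q -> z != u.
  rewrite inE => /predU1P[-> //|].
  elim: (rcons p1 v) (x) Pp => //= y s IH b /andP[/and3P[_ yu _] /IH{}IH].
  by rewrite inE => /predU1P[->|//]; move: yu; rewrite !inE.
have Uq : uniq (u :: q).
  move: Up; rewrite -[_ && _]/(uniq ((x :: rcons p1 v) ++ p2)) cat_uniq.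
  move=> /andP[Uq _].
  by rewrite cons_uniq Uq andbT; apply/negP => /qP; rewrite eqxx.
have szq : size q = (size p1).+2 by rewrite /= size_rcons.
have wn : w (size q) = v.
  by rewrite szq /w /q /= nth_rcons ltnn eqxx.
exists (size q), w; split.
- by split; rewrite ?wn ?szq.
- case=> [//|[|h]] /=; first by rewrite /w.
  rewrite size_rcons !ltnS /w /= nth_rcons => hp; rewrite hp.
  by apply: contra p1A => ?; apply/hasP; exists (nth u p1 h); rewrite ?mem_nth.
- by move=> h h' hn h'n /eqP; rewrite nth_uniq // => /eqP.
- move=> h hq; have /(pathP u) : path (@adj G) u q; last exact.
  by rewrite /= ux; apply: sub_path Pp => y z /and3P[].
Qed.

(** * Labellings of the colours at each vertex *)

Local Notation inset A := (fun z => is_true (z \in A)).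

Section Avoid.
Variables (G : sgraph) (L : eqType).
Implicit Types (c : total_coloring G 'I_4) (lab : G -> 'I_4 -> L).

Definition avoid_linked c lab (A : {set G}) y m y' m' : Prop :=
  exists a b, [/\ linked c (inset A) y a y' b, lab y a != m & lab y' b != m'].

Definition label_inj c lab (A : {set G}) : Prop :=
  forall x a b, x \in A -> a != vcol c x -> b != vcol c x ->
    lab x a = lab x b -> a = b.

Definition strongly_labelled c lab (A : {set G}) : Prop :=
  label_inj c lab A /\
  forall y y' m m', y \in A -> y' \in A -> y != y' -> m != m' ->
    avoid_linked c lab A y m y' m'.

Lemma avoid_linked_sym c lab A y m y' m' :
  avoid_linked c lab A y m y' m' -> avoid_linked c lab A y' m' y m.
Proof. by move=> [a [b [/linked_sym]]]; exists b, a. Qed.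

End Avoid.

(* Of two routes, one starting with label [l'] and ending with [l], the other
   the opposite, one avoids [m] at its start and [m'] at its end. *)
Lemma two_routes (L : eqType) (l l' m m' : L) : l != l' -> m != m' ->
  (l' != m) && (l != m') \/ (l != m) && (l' != m').
Proof.
move=> ll' mm'; have [E|_] := eqVneq l' m; first by right; rewrite -E ll' E.
have [E|_] := eqVneq l m'; last by left.
by right; rewrite -E (eq_sym l') ll' E eq_sym mm'.
Qed.

(** * Adding one ear *)

Section Ear.
Variables (G : sgraph) (A : {set G}) (n : nat) (w : nat -> G).
Variables (c : total_coloring G 'I_4) (lab : G -> 'I_4 -> 'I_3).
Variable (s : nat -> 'I_4).

Let l := lab (w 0) (s 1).
Let l' := lab (w n) (s n.*2.-1).

Hypotheses (n1 : 1 < n) (w0A : w 0 \in A) (wnA : w n \in A).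
Hypothesis w_out : forall h, 0 < h < n -> w h \notin A.
Hypothesis w_inj : forall h h', h <= n -> h' <= n -> w h = w h' -> h = h'.
Hypothesis w_adj : forall h, h < n -> adj (w h) (w h.+1).
Hypothesis sp : spaced n.*2 s.
Hypotheses (s0 : s 0 = vcol c (w 0)) (sn : s n.*2 = vcol c (w n)).

Let ws := mkseq w n.+1.
Let pos z := index z ws.

Definition ear_set : {set G} := A :|: [set z in ws].

(** Entry [h.*2] of [s] colours [w h], and entry [h.*2.+1] the edge from [w h] to [w h.+1]; on such
    an edge, [find] returns the index [h] of its first end. *)
Definition ear_coloring : total_coloring G 'I_4 :=
  TotalColoring
    (fun z => if z \in A then vcol c z else s (pos z).*2)
    (fun S => if S \subset A then ecol c S else s (find (mem S) ws).*2.+1).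

(** At an inner vertex the colour of neither ear edge gets a third label. The [pick] always
    succeeds, there being three labels, so the default [l] is never taken. *)
Definition ear_label (z : G) (b : 'I_4) : 'I_3 :=
  if z \in A then lab z b
  else if b == s (pos z).*2.-1 then l'
  else if b == s (pos z).*2.+1 then l
  else odflt l [pick t | (t != l) && (t != l')].

Let c' := ear_coloring.
Let A' := ear_set.

Let nth_ws h : h <= n -> nth (w 0) ws h = w h.
Proof. by move=> hn; rewrite nth_mkseq. Qed.

Let mem_ws h : h <= n -> w h \in ws.
Proof. by move=> hn; rewrite -nth_ws // mem_nth // size_mkseq. Qed.

Let ws_out i j : i < j <= n -> w j != w i.
Proof. by move=> /andP[ij jn]; apply/eqP => /w_inj E; move: E; lia. Qed.

Let posE h : h <= n -> pos (w h) = h.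
Proof.
move=> hn; have lt_pos : pos (w h) < n.+1.
  by rewrite -[n.+1](size_mkseq w) index_mem mem_ws.
by apply: w_inj => //; rewrite -nth_ws // nth_index // mem_ws.
Qed.

Let vcolE h : h <= n -> vcol c' (w h) = s h.*2.
Proof.
move=> hn; rewrite /=; case: ifPn => [hA|_]; last by rewrite posE.
have [->|h0] := eqVneq h 0; first by rewrite s0.
have [->|hn'] := eqVneq h n; first by rewrite sn.
by move: hA; rewrite (negbTE (w_out _)) //; lia.
Qed.

Let ecolE h : h < n -> ecol c' [set w h; w h.+1] = s h.*2.+1.
Proof.
move=> hn; set S := [set _; _].
have -> : ecol c' S = if S \subset A then ecol c S else
  s (find (mem S) ws).*2.+1 by [].
(* The ear has at least two edges, so each of them has an inner vertex as an end and is not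
   contained in [A]. *)
rewrite ifN; last first.
  apply/negP=> /subsetP sub.
  have [h0|h0] := posnP h.
    have := w_out (h := h.+1); rewrite sub ?inE ?eqxx ?orbT //.
    by rewrite h0 n1 => /(_ isT).
  by have := w_out (h := h); rewrite sub ?inE ?eqxx // h0 hn => /(_ isT).
congr (s _.*2.+1).
have hS : w h \in S by rewrite !inE eqxx.
have hasS : has (mem S) ws.
  by apply/hasP; exists (w h); rewrite // mem_ws // ltnW.
have lt_f : find (mem S) ws < n.+1 by rewrite -[n.+1](size_mkseq w) -has_find.
have le_f : find (mem S) ws <= h.
  rewrite leqNgt; apply/negP => /(before_find (w 0)).
  by rewrite nth_ws ?(ltnW hn) //= hS.
have fS : w (find (mem S) ws) \in S.
  by have := nth_find (w 0) hasS; rewrite nth_ws.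
move: (find _ ws) lt_f le_f fS => f lt_f le_f.
by rewrite !inE => /orP[]/eqP/w_inj E; move: E; lia.
Qed.

Let ear_edge h : h < n -> proper_edge c' (w h) (w h.+1).
Proof.
move=> hn; rewrite /proper_edge w_adj // ecolE // !vcolE ?(ltnW hn) // doubleS.
have [s1 s2] := sp h.*2; have [s3 _] := sp h.*2.+1.
by rewrite s2 1?(eq_sym (s _.+1) (s h.*2)) ?s1 ?s3 //; lia.
Qed.

Let B i j z := exists2 h, i <= h <= j & z = w h.

Let segment i j : i < j <= n ->
  linked c' (B i j) (w i) (s i.*2.+1) (w j) (s j.*2.-1).
Proof.
elim: j => // j IH /andP[]; rewrite ltnS leq_eqVlt => /predU1P[<-|ij] jn.
  rewrite -ecolE //; apply: linked_edge; first exact: ear_edge.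
    by exists i => //; lia.
  by exists i.+1 => //; lia.
have e : linked c' (B j j.+1) (w j) (s j.*2.+1) (w j.+1) (s j.*2.+1).
  by rewrite -ecolE //; apply: linked_edge; [exact: ear_edge|exists j => //; lia
    |exists j.+1 => //; lia].
have {}IH := IH (_ : i < j <= n); rewrite ij ltnW // in IH.
apply: (linked_cat (IH isT) e).
(* The edges meeting at [w j] carry the entries [j.*2.-1] and [j.*2.+1], which are two apart. *)
- have [_ s1] := sp j.*2.-1; have j0 : 0 < j by lia.
  have -> : j.*2.+1 = j.*2.-1.+2 by lia.
  by apply: s1; lia.
- move=> z [h hij ->] [h' hj /w_inj E]; congr w; move: E; lia.
- by move=> z [h hij ->]; exists h => //; lia.
- by move=> z [h hij ->]; exists h => //; lia.
Qed.

Let B_sub i j z : j <= n -> B i j z -> z \in A'.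
Proof.
move=> jn [h hij ->]; rewrite /A' /ear_set inE [X in _ || X]inE mem_ws ?orbT //.
by lia.
Qed.

Let A_sub z : z \in A -> z \in A'.
Proof. by move=> zA; rewrite inE zA. Qed.

Let old_linked u a v b :
  linked c (inset A) u a v b -> linked c' (inset A) u a v b.
Proof.
apply: linked_recolor => [x|x y] /= xA; first by rewrite xA.
by move=> yA; rewrite ifT //; apply/subsetP => z; rewrite !inE => /orP[]/eqP->.
Qed.

Lemma ear_old y m y' m' : y \in A -> y' \in A ->
  avoid_linked c lab A y m y' m' -> avoid_linked c' ear_label A' y m y' m'.
Proof.
move=> yA y'A [a [b [/old_linked Lab am bm]]]; exists a, b.
rewrite /ear_label yA y'A; split=> //.
by apply: linked_sub Lab => z /=; apply: A_sub.
Qed.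

Lemma ear_path : linked c' (inset A') (w 0) (s 1) (w n) (s n.*2.-1).
Proof.
have := segment (_ : 0 < n <= n); rewrite leqnn ltnW // => /(_ isT).
by apply: linked_sub => z; apply: B_sub.
Qed.

Hypothesis ll' : l != l'.
Hypothesis lab_inj : label_inj c lab A.
(** This and [from_end] are the only instances of strong labelling required to extend routes into
    [A]. They also hold when [A] is a single edge, which is not strongly labelled, so the section
    serves the initial cycle as well. *)
Hypothesis from_start : forall y m, y \in A -> y != w 0 -> l != m ->
  avoid_linked c lab A (w 0) l y m.
Hypothesis from_end : forall y m, y \in A -> y != w n -> l' != m ->
  avoid_linked c lab A (w n) l' y m.

Let label_tail i : 0 < i < n -> ear_label (w i) (s i.*2.-1) = l'.
Proof.
by move=> hi; rewrite /ear_label (negbTE (w_out hi)) posE ?eqxx //; lia.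
Qed.

Let label_head i : 0 < i < n -> ear_label (w i) (s i.*2.+1) = l.
Proof.
move=> hi; rewrite /ear_label (negbTE (w_out hi)) posE; last lia.
have [_ s1] := sp i.*2.-1; have E : i.*2.+1 = i.*2.-1.+2 by lia.
by rewrite {1}E eq_sym (negbTE (s1 _)) ?eqxx //; lia.
Qed.

Let label_old y a : y \in A -> ear_label y a = lab y a.
Proof. by rewrite /ear_label => ->. Qed.

(** The ear reaches [w 0] by an edge labelled [l] there. Avoiding the label [l] when continuing in
    [A] therefore makes the two edge colours at [w 0] differ. *)
Let start_route i y m' : 0 < i < n -> y \in A -> l != m' ->
  exists2 b, linked c' (inset A') (w i) (s i.*2.-1) y b & ear_label y b != m'.
Proof.
move=> hi yA lm.
have seg : linked c' (B 0 i) (w i) (s i.*2.-1) (w 0) (s 1).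
  by apply/linked_sym/segment; lia.
have [->|yw] := eqVneq y (w 0).
  exists (s 1); last by rewrite label_old.
  by apply: linked_sub seg => z; apply: B_sub; lia.
have [a [b [/old_linked Lab al bm]]] := from_start yA yw lm.
exists b; last by rewrite label_old.
apply: (linked_cat seg Lab).
- by apply: contraNneq al => <-.
- move=> z [h hi' ->] /= hA; have [->//|h0] := posnP h.
  by move: hA; rewrite (negbTE (w_out _)) //; lia.
- by move=> z; apply: B_sub; lia.
- by move=> z /=; apply: A_sub.
Qed.

Let end_route i y m' : 0 < i < n -> y \in A -> l' != m' ->
  exists2 b, linked c' (inset A') (w i) (s i.*2.+1) y b & ear_label y b != m'.
Proof.
move=> hi yA lm.
have seg : linked c' (B i n) (w i) (s i.*2.+1) (w n) (s n.*2.-1).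
  by apply/segment; lia.
have [->|yw] := eqVneq y (w n).
  exists (s n.*2.-1); last by rewrite label_old.
  by apply: linked_sub seg => z; apply: B_sub; lia.
have [a [b [/old_linked Lab al bm]]] := from_end yA yw lm.
exists b; last by rewrite label_old.
apply: (linked_cat seg Lab).
- by apply: contraNneq al => <-.
- move=> z [h hi' ->] /= hA; have [->//|h0] := eqVneq h n.
  by move: hA; rewrite (negbTE (w_out _)) //; lia.
- by move=> z; apply: B_sub; lia.
- by move=> z /=; apply: A_sub.
Qed.

Let ear_to_old i y m m' : 0 < i < n -> y \in A -> m != m' ->
  avoid_linked c' ear_label A' (w i) m y m'.
Proof.
move=> hi yA mm'; case: (two_routes ll' mm') => /andP[lm lm'].
  have [b Lb bm] := start_route hi yA lm'.
  by exists (s i.*2.-1), b; rewrite label_tail.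
have [b Lb bm] := end_route hi yA lm'.
by exists (s i.*2.+1), b; rewrite label_head.
Qed.

(** One route follows the ear directly, with labels [l] then [l']. The other goes back to [w 0],
    through [A] to [w n], and back along the ear, with labels [l'] then [l]; its middle part must
    avoid [l] at [w 0] and [l'] at [w n], which [ll'] permits. *)
Let ear_to_ear i j m m' : 0 < i -> i < j -> j < n -> m != m' ->
  avoid_linked c' ear_label A' (w i) m (w j) m'.
Proof.
move=> i0 ij jn mm'; have hi : 0 < i < n by lia.
have hj : 0 < j < n by lia.
case: (two_routes ll' mm') => /andP[lm lm']; last first.
  exists (s i.*2.+1), (s j.*2.-1); rewrite label_head // label_tail //.
  split=> //.
  have /segment : i < j <= n by lia.
  by apply: linked_sub => z; apply: B_sub; lia.
exists (s i.*2.-1), (s j.*2.+1); rewrite label_tail // label_head //.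
split=> //.
have seg1 : linked c' (B 0 i) (w i) (s i.*2.-1) (w 0) (s 1).
  by apply/linked_sym/segment; lia.
have seg2 : linked c' (B j n) (w n) (s n.*2.-1) (w j) (s j.*2.+1).
  by apply/linked_sym/segment; lia.
have wn0 : w n != w 0 by apply: ws_out; lia.
have [a [b [/old_linked Lab al bm]]] := from_start wnA wn0 ll'.
have L1 : linked c' (fun z => z \in A \/ B 0 i z) (w i) (s i.*2.-1) (w n) b.
  apply: (linked_cat seg1 Lab).
  - by apply: contraNneq al => <-.
  - move=> z [h hi' ->] /= hA; have [->//|h0] := posnP h.
    by move: hA; rewrite (negbTE (w_out _)) //; lia.
  - by right.
  - by left.
apply: (linked_cat L1 seg2).
- by apply: contraNneq bm => ->.
- move=> z [hA|[h' hi' ->]] [h hj' zh].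
    rewrite zh in hA *; have [->//|h0] := eqVneq h n.
    by move: hA; rewrite (negbTE (w_out _)) //; lia.
  by move/w_inj: zh => E; move: E; lia.
- by move=> z [|]; [exact: A_sub|apply: B_sub; lia].
- by move=> z; apply: B_sub; lia.
Qed.

Let ear_setP z : z \in A' -> z \in A \/ exists2 i, 0 < i < n & z = w i.
Proof.
rewrite in_setU [X in _ || X]inE => /orP[|/mapP[h]]; first by left.
rewrite mem_iota => hn zh; have [zA|zA] := boolP (z \in A); first by left.
right; exists h => //; rewrite zh in zA.
have h0 : h != 0 by apply: contraNneq zA => ->.
have hn' : h != n by apply: contraNneq zA => ->.
lia.
Qed.

Lemma ear_label_inj : label_inj c' ear_label A'.
Proof.
move=> x a b /ear_setP[xA|[i hi ->]].
  by rewrite !label_old //= xA; apply: lab_inj.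
have hin : i <= n by lia.
rewrite vcolE // /ear_label (negbTE (w_out hi)) posE //.
set t := odflt l _.
have [tl tl'] : t != l /\ t != l'.
  rewrite /t; case: pickP => [t' /andP[]//|none].
  have [t'] := @exists_notin 3 [:: l; l'] isT.
  by rewrite !inE negb_or none.
set p := s i.*2.-1; set q := s i.*2.+1; set v := s i.*2.
have [vp qv qp] : [/\ v != p, q != v & q != p].
  have [s1 s2] := sp i.*2.-1; have [s3 _] := sp i.*2.
  have E : i.*2.-1.+1 = i.*2 by lia.
  by rewrite E in s1 s2; rewrite !(eq_sym q) (eq_sym v) s1 ?s2 ?s3 //; lia.
have [l'l lt l't] : [/\ l' == l = false, l == t = false & l' == t = false].
  by rewrite !(eq_sym _ t) eq_sym; split; apply/negbTE.
move=> av bv.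
have [ap|ap] := eqVneq a p; have [bp|bp] := eqVneq b p; first by rewrite ap bp.
- by have [_|_] := eqVneq b q; move/eqP; rewrite ?l'l ?l't.
- by have [_|_] := eqVneq a q; move/esym/eqP; rewrite ?l'l ?l't.
have [aq|aq] := eqVneq a q; have [bq|bq] := eqVneq b q; first by rewrite aq bq.
- by move/eqP; rewrite lt.
- by move/esym/eqP; rewrite lt.
(* Otherwise [a], [b], the two ear edges and the vertex would show five distinct colours. *)
move=> _; apply/eqP/negPn/negP => ab.
have : uniq [:: a; b; p; q; v].
  rewrite /= !inE !negb_or ab ap aq av bp bq bv (eq_sym p) qp (eq_sym p).
  by rewrite vp qv.
move/card_uniqP => /= E; have := max_card (mem [:: a; b; p; q; v]).
by rewrite E card_ord.
Qed.

Lemma ear_new x z m m' : x \in A' -> z \in A' -> x != z ->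
  ~~ ((x \in A) && (z \in A)) -> m != m' ->
  avoid_linked c' ear_label A' x m z m'.
Proof.
move=> /ear_setP[xA|[i hi ->]] /ear_setP[zA|[j hj ->]] xz out mm'.
- by rewrite xA zA in out.
- by apply/avoid_linked_sym/ear_to_old => //; rewrite eq_sym.
- exact: ear_to_old.
have [ij|ji|ij] := ltngtP i j; last by rewrite ij eqxx in xz.
  by apply: ear_to_ear; lia.
by apply/avoid_linked_sym/ear_to_ear; rewrite 1?eq_sym //; lia.
Qed.

Lemma ear_set_proper : A \proper A'.
Proof.
apply/properP; split; first by apply/subsetP => z; apply: A_sub.
by exists (w 1); rewrite ?w_out // inE [X in _ || X]inE mem_ws ?orbT // ltnW.
Qed.

End Ear.

(** * The initial cycle, and growth to the whole graph *)

Lemma exists_adj (G : sgraph) : two_connected G -> exists u v : G, adj u v.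
Proof.
move=> G2; have [_ conn] := two_connected_connected G2.
have /card_gt1P[a [b [_ _ ab]]] : 1 < #|G| by case: G2 => /ltnW.
have /connectP[[|x p] /=] := conn a b (in_setT a) (in_setT b).
  by move=> _ E; rewrite E eqxx in ab.
by move=> /andP[/and3P[_ _ ax] _] _; exists a, x.
Qed.

(** An edge and an ear on its ends form a cycle. Orient it along the ear and back over the edge: at
    every vertex the edge ahead has label 0 and the edge behind label 1, so the two ways round are
    the routes of [two_routes]. *)
Lemma strongly_labelled_cycle (G : sgraph) : two_connected G ->
  exists (A : {set G}) c (lab : G -> 'I_4 -> 'I_3),
    1 < #|A| /\ strongly_labelled c lab A.
Proof.
move=> G2; have [u0 [v0 uv0]] := exists_adj G2.
have ne0 : u0 != v0 by apply: contraTneq uv0 => ->; rewrite adj_irr.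
have A1 : 1 < #|[set u0; v0]| by rewrite cards2 ne0.
have AT : [set u0; v0] != setT.
  by apply/eqP => E; case: G2 => + _; rewrite -cardsT -E cards2 ne0.
have [n [w [[n1 w0A wnA] w_out w_inj w_adj]]] := exists_ear G2 A1 AT.
have w0n : w 0 != w n by apply/eqP => /w_inj E; move: E n1; lia.
have [AE uv] : [set u0; v0] = [set w 0; w n] /\ adj (w 0) (w n).
  move: w0A wnA w0n.
  rewrite !inE => /orP[]/eqP-> /orP[]/eqP->; rewrite ?eqxx //.
  by rewrite setUC adj_sym.
rewrite AE {ne0 uv0 AT AE} in A1 w0A wnA w_out.
set A := [set w 0; w n] in A1 w0A wnA w_out.
pose o i : 'I_4 := inord i.
have o_inj i j : i < 4 -> j < 4 -> (o i == o j) = (i == j).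
  by move=> i4 j4; rewrite -val_eqE /= !inordK.
(* The edge joining the ends, coloured 0 and 1, will have colour 2; the ear leaves [w 0] by colour 1
   and enters [w n] by colour 3. *)
have [s [sp s0 s1 sr sn]] :=
  @spaced_fill (n - 2) (o 0) (o 1) (o 3) (o 1) ltac:(by rewrite o_inj)
    ltac:(by rewrite o_inj) ltac:(by rewrite o_inj) ltac:(by rewrite eqxx orbT).
have En : (n - 2).*2 + 4 = n.*2 by lia.
have En' : (n - 2).*2 + 3 = n.*2.-1 by lia.
rewrite En in sp sn; rewrite En' in sr.
pose c := TotalColoring (fun z => if z == w 0 then o 0 else o 1) (fun=> o 2).
(* The colours 1, 2, 3 get the labels 0, 1, 2 at [w 0], and the colours
   2, 3, 0 get the labels 0, 1, 2 at [w n]. *)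
pose lab (z : G) (b : 'I_4) : 'I_3 :=
  inord (if z == w 0 then (b + 3) %% 4 else (b + 2) %% 4).
have wn0 : (w n == w 0) = false by rewrite eq_sym (negbTE w0n).
have cn : vcol c (w n) = o 1 by rewrite /= wn0.
have c0 : vcol c (w 0) = o 0 by rewrite /= eqxx.
have lab0 i : 0 < i < 4 -> lab (w 0) (o i) = i.-1 :> nat.
  by rewrite /lab eqxx; case: i => [|[|[|[|]]]] //; rewrite /o !inordK.
have labn i : 1 < i < 4 -> lab (w n) (o i) = i.-2 :> nat.
  rewrite /lab wn0.
  by case: i => [|[|[|[|]]]] //; rewrite /o !inordK.
have ll' : lab (w 0) (s 1) != lab (w n) (s n.*2.-1).
  by rewrite s1 sr -val_eqE /= lab0 ?labn.
have inj : label_inj c lab A.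
  move=> x a b; rewrite !inE => /orP[]/eqP->; rewrite ?c0 ?cn /lab -!val_eqE /=.
    rewrite eqxx !inordK // => a0 b0 /(congr1 val).
    rewrite /= !inordK => [E||]; first apply/val_inj;
      by move: (ltn_ord a) (ltn_ord b) => /=; lia.
  rewrite wn0 !inordK // => a0 b0 /(congr1 val).
  rewrite /= !inordK => [E||]; first apply/val_inj;
    by move: (ltn_ord a) (ltn_ord b) => /=; lia.
have e : proper_edge c (w 0) (w n).
  by rewrite /proper_edge uv cn c0 /= !o_inj.
have L : linked c (inset A) (w 0) (o 2) (w n) (o 2) by exact: linked_edge.
have from_start y m : y \in A -> y != w 0 -> lab (w 0) (s 1) != m ->
    avoid_linked c lab A (w 0) (lab (w 0) (s 1)) y m.
  rewrite !inE => /orP[]/eqP->; rewrite ?eqxx // => _; rewrite s1 => m0.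
  exists (o 2), (o 2); split=> //; first by rewrite -val_eqE /= !lab0.
  by apply: contraNneq m0 => <-; rewrite -val_eqE /= lab0 ?labn.
have from_end y m : y \in A -> y != w n -> lab (w n) (s n.*2.-1) != m ->
    avoid_linked c lab A (w n) (lab (w n) (s n.*2.-1)) y m.
  rewrite !inE => /orP[]/eqP->; rewrite ?eqxx // => _; rewrite sr => m0.
  exists (o 2), (o 2); split; first exact: linked_sym.
    by rewrite -val_eqE /= !labn.
  by apply: contraNneq m0 => <-; rewrite -val_eqE /= lab0 ?labn.
have s0' : s 0 = vcol c (w 0) by rewrite s0 c0.
have sn' : s n.*2 = vcol c (w n) by rewrite sn cn.
exists (ear_set A n w), (ear_coloring A n w c s), (ear_label A n w lab s); split.
  apply: leq_trans A1 (subset_leq_card _); apply: proper_sub.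
  exact: ear_set_proper.
split; first exact: ear_label_inj.
move=> y y' m m' yA y'A yy' mm'.
have [/andP[yA0 y'A0]|out] := boolP ((y \in A) && (y' \in A)); last first.
  exact: (ear_new (c := c)).
(* The only pair inside [A] is the two ends; their two routes are the initial edge and the whole
   ear. *)
suff K m1 m2 : m1 != m2 -> avoid_linked (ear_coloring A n w c s)
    (ear_label A n w lab s) (ear_set A n w) (w 0) m1 (w n) m2.
  move: yA0 y'A0 yy'.
  rewrite !inE => /orP[]/eqP-> /orP[]/eqP->; rewrite ?eqxx // => _.
    exact: K.
  by apply/avoid_linked_sym/K; rewrite eq_sym.
move=> m12; case: (two_routes ll' m12) => /andP[lm lm'].
  apply: ear_old => //; exists (o 2), (o 2); split=> //.
    by move: lm; rewrite sr -!val_eqE /= !lab0 ?labn.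
  by move: lm'; rewrite s1 -!val_eqE /= !labn ?lab0.
exists (s 1), (s n.*2.-1); rewrite /ear_label w0A wnA; split=> //.
exact: ear_path.
Qed.

Lemma strongly_labelled_grow (G : sgraph) (A : {set G}) c
    (lab : G -> 'I_4 -> 'I_3) :
  two_connected G -> 1 < #|A| -> A != setT -> strongly_labelled c lab A ->
  exists (A' : {set G}) c' (lab' : G -> 'I_4 -> 'I_3),
    A \proper A' /\ strongly_labelled c' lab' A'.
Proof.
move=> G2 A1 AT [inj conn].
have [n [w [[n1 w0A wnA] w_out w_inj w_adj]]] := exists_ear G2 A1 AT.
have w0n : w 0 != w n by apply/eqP => /w_inj E; move: E n1; lia.
set x := vcol c (w 0); set t := vcol c (w n).
(* [y] will colour the first ear edge; it is [t] unless [t = x], as [spaced_fill] requires. *)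
have [y xy ty] : exists2 y, x != y & (t == x) || (t == y).
  have [->|tx] := eqVneq t x; last by exists t; rewrite ?eqxx // eq_sym.
  have [y] := @exists_notin 4 [:: x] isT.
  by rewrite inE eq_sym; exists y.
(* Two colours are available for the last ear edge. Both differ from [t], so their labels at [w n]
   are distinct, and one of them is not the label of [y] at [w 0]. *)
have [r [xr yr rl]] :
    exists r, [/\ x != r, y != r & lab (w 0) y != lab (w n) r].
  have [r1] := @exists_notin 4 [:: x; y] isT.
  have [r2] := @exists_notin 4 [:: x; y; r1] isT.
  rewrite !inE !negb_or => /and3P[r2x r2y r21] /andP[r1x r1y].
  have [E|ne] := eqVneq (lab (w 0) y) (lab (w n) r1); last first.
    by exists r1; rewrite ne !(eq_sym _ r1).
  exists r2; rewrite !(eq_sym _ r2); split=> //; apply: contraNneq r21.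
  rewrite E eq_sym => /inj -> //; rewrite -/t.
    by case/orP: ty => /eqP->.
  by case/orP: ty => /eqP->.
have [s [sp s0 s1 sr sn]] := spaced_fill (n - 2) xy xr yr ty.
have En : (n - 2).*2 + 4 = n.*2 by lia.
have En' : (n - 2).*2 + 3 = n.*2.-1 by lia.
rewrite En in sp sn; rewrite En' in sr.
have ll' : lab (w 0) (s 1) != lab (w n) (s n.*2.-1) by rewrite s1 sr.
exists (ear_set A n w), (ear_coloring A n w c s), (ear_label A n w lab s); split.
  exact: ear_set_proper.
split; first exact: ear_label_inj.
move=> z z' m m' zA z'A zz' mm'.
have [/andP[zA0 z'A0]|out] := boolP ((z \in A) && (z' \in A)).
  by apply: ear_old => //; apply: conn.
apply: (ear_new (c := c)) => // b m0 bA bw lm; apply: conn => //;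
  by rewrite eq_sym.
Qed.

Lemma exists_strong_labelling (G : sgraph) : two_connected G ->
  exists c (lab : G -> 'I_4 -> 'I_3), strongly_labelled c lab [set: G].
Proof.
move=> G2; have [A [c [lab [A1 HA]]]] := strongly_labelled_cycle G2.
have [k] := ubnP #|~: A|; elim: k A c lab A1 HA => // k IH A c lab A1 HA ltk.
have [AT|AT] := eqVneq A setT; first by exists c, lab; rewrite -AT.
have [A' [c' [lab' [AA' HA']]]] := strongly_labelled_grow G2 A1 AT HA.
have ltA := proper_card AA'.
apply: (IH A' c' lab') => //; first exact: ltn_trans ltA.
by apply: leq_trans (proper_card _) ltk; rewrite properC.
Qed.

(** * From labels to the strong property *)

(** If a path has different labels at its two ends, a second path can avoid both of them at once. If
    both are the same label, one path avoids it at [u] and another avoids it at [v]: either one of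
    these differs from the first path at both ends, or the two differ from each other at both
    ends. *)
Lemma strongly_labelled_two_ways (G : sgraph) c (lab : G -> 'I_4 -> 'I_3)
    (A : {set G}) u v :
  strongly_labelled c lab A -> u \in A -> v \in A -> u != v ->
  exists a b a' b', [/\ linked c (inset A) u a v b,
    linked c (inset A) u a' v b', a != a' & b != b'].
Proof.
move=> [_ conn] uA vA uv; have {}conn m m' := conn u v m m' uA vA uv.
have neq x y y' : lab x y != lab x y' -> y != y' by apply: contraNneq => ->.
have [a [b [L1 _ _]]] :=
  conn (inord 0) (inord 1) ltac:(by rewrite -val_eqE /= !inordK).
have [E|ne] := eqVneq (lab u a) (lab v b); last first.
  have [a' [b' [L2 /neq aa' /neq bb']]] := conn _ _ ne.
  by exists a, b, a', b'; rewrite eq_sym aa' eq_sym bb'.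
(* [t] only serves to make the two avoided labels distinct. *)
have [t] := @exists_notin 3 [:: lab u a] isT; rewrite inE => tu.
have [a2 [b2 [L2 ua2 _]]] := conn (lab u a) t ltac:(by rewrite eq_sym).
have [Eb2|nb2] := eqVneq (lab v b2) (lab v b); last first.
  by exists a2, b2, a, b; rewrite (neq u) // (neq v).
have [a3 [b3 [L3 _]]] := conn t (lab u a) tu; rewrite E => vb3.
have [Ea3|na3] := eqVneq (lab u a3) (lab u a); last first.
  by exists a3, b3, a, b; rewrite (neq u) // (neq v).
by exists a2, b2, a3, b3; rewrite (neq u) ?Ea3 // (neq v) // Eb2 eq_sym.
Qed.

Lemma strongly_labelled_strong (G : sgraph) c (lab : G -> 'I_4 -> 'I_3) :
  strongly_labelled c lab [set: G] -> strong_property c.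
Proof.
move=> Hc u v uv.
have card3 (T : finType) (x y z : T) :
    x <> y -> x <> z -> y != z -> #|[set x; y; z]| = 3.
  move=> /eqP xy /eqP xz yz; rewrite setUC cardsU1 cards2 xy !inE.
  by rewrite (eq_sym z x) (negbTE xz) eq_sym (negbTE yz).
have [a [b [a' [b' [L1 L2 aa' bb']]]]] :=
  strongly_labelled_two_ways Hc (in_setT u) (in_setT v) uv.
have [p [Tp sp ep [su ev] [ua vb]]] := linked_total_proper L1.
have [q [Tq sq eq [su' ev'] [ua' vb']]] := linked_total_proper L2.
by exists p, q; split=> //; rewrite ?sp ?sq ?ep ?eq card3.
Qed.

Theorem theorem3 (G : sgraph) (G2 : two_connected G) :
  tpc (two_connected_connected G2) <= 4 /\
  exists c : total_coloring G 'I_4,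
    total_proper_connected c /\ strong_property c.
Proof.
have [c [lab /strongly_labelled_strong strong]] := exists_strong_labelling G2.
have tp : total_proper_connected c.
  by move=> u v /strong[p [_ [Tp _ _ _ _]]]; exists p.
split; last by exists c.
by rewrite /tpc; case: ex_minnP => k _; apply; apply/asboolP; exists c.
Qed.
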